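(* Let $G$ be a nonempty hypergraph on the vertex set $\{1,\dots,n\}$ and let $t\ge 1$ be an integer. Then \[ \operatorname{reg}\bigl(J(G)^{(t)}\bigr)=2+\max\Bigl\{\operatorname{hdim}_{\mathrm{k}}\bigl(\Delta(J(H))\bigr)+|\mathbf a^{<t}| \;\Big|\; (H,\mathbf a)\text{ is a } t\text{-critical pair of } G\Bigr\}. \]
   Context: A hypergraph $G$ has a finite vertex set $V(G)=[n]=\{1,\dots,n\}$ and a set $E(G)$ of edges, which are subsets of $V(G)$, no edge being properly contained in another; $G$ is assumed to have no isolated vertices (subhypergraphs of $G$ may have them). Let $\mathrm{k}$ be a field and $S=\mathrm{k}[x_1,\dots,x_n]$ with the standard grading. The cover ideal is $J(G)=\bigcap_{e\in E(G)}(x_i\mid i\in e)$, and $J(G)^{(t)}=\bigcap_{e\in E(G)}(x_i\mid i\in e)^t$. $\operatorname{reg}$ is Castelnuovo–Mumford regularity (of the ideal as a graded $S$-module). For $\mathbf a=(a_1,\dots,a_n)\in\mathbb N^n$ (with $0\in\mathbb N$), $|\mathbf a|=a_1+\cdots+a_n$, and $\mathbf a^{<t}$ is the vector whose $i$-th coordinate is $a_i$ if $a_i<t$ and $0$ otherwise. The $t$-admissible subhypergraph of $G$ with respect to $\mathbf a\in\mathbb N^n$ is the hypergraph $H$ with $V(H)=\{i\mid a_i<t\}$ and $E(H)=\{e\in E(G)\mid \sum_{i\in e}a_i<t\}$; then $(H,\mathbf a)$ is called a $t$-admissible pair. For such $H$, $J(H)=\bigcap_{e\in E(H)}(x_i\mid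 i\in e)$ is viewed as an ideal of the polynomial ring with variables indexed by $V(H)$ (the unit ideal if $E(H)=\emptyset$), and $\Delta(J(H))$ is its Stanley–Reisner complex on the ground set $V(H)$: $\Delta(J(H))=\{F\subseteq V(H)\mid \prod_{i\in F}x_i\notin J(H)\}$, i.e. the sets $F\subseteq V(H)$ disjoint from some edge of $H$. A simplicial complex $\Delta$ is acyclic (over $\mathrm{k}$) if $\widetilde H_i(\Delta;\mathrm{k})=0$ for all $i$; the void complex $\emptyset$ is acyclic, while $\{\emptyset\}$ has $\widetilde H_{-1}\ne 0$. If $\Delta$ is not acyclic, $\operatorname{hdim}_{\mathrm{k}}(\Delta)=\max\{i\mid \widetilde H_i(\Delta;\mathrm{k})\neq 0\}$. A $t$-admissible pair $(H,\mathbf a)$ of $G$ is a $t$-critical pair if $\Delta(J(H))$ is not acyclic. *)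

(* Defs.v *)
From HB Require Import structures.
From mathcomp Require Import all_boot all_order all_algebra.
From mathcomp Require Export fraction mpoly.

Set Implicit Arguments.
Unset Strict Implicit.
Unset Printing Implicit Defensive.

Import Order.TTheory GRing.Theory Num.Theory.
Local Open Scope ring_scope.

Definition is_max (A : int -> Prop) (m : int) : Prop :=
  A m /\ forall s, A s -> s <= m.

(* [pos i F] is the number of elements of F smaller than i; it gives the signs
   of the simplicial boundary and of the Cech differential. *)
Definition pos n (i : 'I_n) (F : {set 'I_n}) : nat := #|[set j in F | (j < i)%N]|.

(** * Hypergraphs *)

Record hypergraph (n : nat) := Hypergraph {
  vset : {set 'I_n};
  eset : {set {set 'I_n}};
  eset_sub : [forall e in eset, e \subset vset];
  eset_antichain : [forall e in eset, forall f in eset, ~~ (e \proper f)]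
}.

Definition no_isolated_vertex n (G : hypergraph n) : Prop :=
  forall i, i \in vset G -> exists2 e, e \in eset G & i \in e.

Section Admissible.
Variables (n : nat) (G : hypergraph n) (t : nat) (a : 'X_{1..n}).

Definition adm_vset : {set 'I_n} := [set i | (a i < t)%N].

Definition adm_eset : {set {set 'I_n}} :=
  [set e in eset G | (\sum_(i in e) a i < t)%N].

Lemma adm_eset_sub : [forall e in adm_eset, e \subset adm_vset].
Proof.
apply/forall_inP => e; rewrite inE => /andP[_ lt_t].
apply/subsetP => i ie; rewrite inE (leq_ltn_trans _ lt_t) //.
by rewrite (bigD1 i) //= leq_addr.
Qed.

Lemma adm_eset_antichain :
  [forall e in adm_eset, forall f in adm_eset, ~~ (e \proper f)].
Proof.
apply/forall_inP => e; rewrite inE => /andP[eG _].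
apply/forall_inP => f; rewrite inE => /andP[fG _].
by have /forall_inP/(_ e eG)/forall_inP/(_ f fG) := eset_antichain G.
Qed.

Definition admissible : hypergraph n :=
  Hypergraph adm_eset_sub adm_eset_antichain.

Definition trunc_exp : 'X_{1..n} :=
  [multinom if (a i < t)%N then a i else 0%N | i < n].

End Admissible.

(** * Ideals of the polynomial ring, as predicates *)

Section Ideals.
Variables (k : fieldType) (n : nat).
Local Notation S := {mpoly k[n]}.

Definition var_ideal (e : {set 'I_n}) (f : S) : Prop :=
  exists g : 'I_n -> S, f = \sum_(i in e) g i * 'X_i.

Definition ideal_mul (I J : S -> Prop) (f : S) : Prop :=
  exists m (u v : 'I_m -> S),
    [/\ forall l, I (u l), forall l, J (v l) & f = \sum_(l < m) u l * v l].

Definition ideal_pow (I : S -> Prop) (t : nat) : S -> Prop :=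
  iter t (ideal_mul I) (fun _ => True).

(* An ideal of k[x_i | i in vset H] is represented by its extension to
   k[x_1, ..., x_n]; both contain the same monomials in the variables of
   vset H (see [SR_coverP]). *)
Definition cover_ideal (H : hypergraph n) (f : S) : Prop :=
  forall e, e \in eset H -> var_ideal e f.

Definition cover_ideal_sympow (G : hypergraph n) (t : nat) (f : S) : Prop :=
  forall e, e \in eset G -> ideal_pow (var_ideal e) t f.

Definition sqfree_mon (F : {set 'I_n}) : S := \prod_(i in F) 'X_i.

(* Stanley-Reisner complex of I on the ground set V. *)
Definition SR_complex (V : {set 'I_n}) (I : S -> Prop) (F : {set 'I_n}) : Prop :=
  F \subset V /\ ~ I (sqfree_mon F).

Definition cover_complex (H : hypergraph n) : {set 'I_n} -> Prop :=
  SR_complex (vset H) (cover_ideal H).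

Lemma var_ideal_sqfree (e F : {set 'I_n}) :
  var_ideal e (sqfree_mon F) <-> ~~ [disjoint F & e].
Proof.
split=> [[g Fg]|/pred0Pn[i /= /andP[iF ie]]].
  apply/negP => dFe; pose v (i : 'I_n) : k := (i \notin e)%:R.
  have ev0 : meval v (sqfree_mon F) = 0.
    rewrite Fg rmorph_sum big1 // => i ie.
    by rewrite /= mevalM mevalXU /v ie mulr0.
  have ev1 : meval v (sqfree_mon F) = 1.
    rewrite /sqfree_mon rmorph_prod big1 // => i iF.
    by rewrite /= mevalXU /v (disjointFr dFe iF).
  by have := oner_neq0 k; rewrite -ev1 ev0 eqxx.
exists (fun j => if j == i then \prod_(l in F | l != i) 'X_l else 0).
rewrite (bigD1 i) //= eqxx [X in _ + X]big1; last first.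
  by move=> j /andP[_ /negbTE->]; rewrite mul0r.
by rewrite addr0 /sqfree_mon (bigD1 i) //= mulrC.
Qed.

Lemma SR_coverP (H : hypergraph n) (F : {set 'I_n}) :
  cover_complex H F <->
  F \subset vset H /\ exists2 e, e \in eset H & [disjoint F & e].
Proof.
split=> -[FV FH]; split=> //; last first.
  by case: FH => e eH dFe /(_ e eH)/var_ideal_sqfree; rewrite dFe.
have [/exists_inP[e eH dFe]|] := boolP [exists e in eset H, [disjoint F & e]].
  by exists e.
rewrite negb_exists_in => /forall_inP nd; case: FH => e eH.
exact/var_ideal_sqfree/nd.
Qed.

End Ideals.

Arguments var_ideal k {n} e f.
Arguments cover_ideal k {n} H f.
Arguments cover_ideal_sympow k {n} G t f.

(** * Reduced simplicial homology *)

Section SimplicialHomology.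
Variables (k : fieldType) (n : nat) (Delta : {set 'I_n} -> Prop).
Implicit Types (i : int) (c : {ffun {set 'I_n} -> k}).

(* Chains are coefficient functions on subsets of the ground set; the empty
   face is the unique face of dimension -1. *)
Definition chain i c : Prop :=
  forall F : {set 'I_n}, c F != 0 -> Delta F /\ #|F|%:Z - 1 = i.

Definition boundary c : {ffun {set 'I_n} -> k} :=
  [ffun F : {set 'I_n} => \sum_(v | v \notin F) (-1) ^+ pos v F * c (v |: F)].

Definition red_homology_neq0 i : Prop :=
  exists c, [/\ chain i c, boundary c = 0
              & ~ exists2 b, chain (i + 1) b & boundary b = c].

Definition acyclic : Prop := forall i, ~ red_homology_neq0 i.

Definition is_hdim (h : int) : Prop := is_max red_homology_neq0 h.

End SimplicialHomology.

(** * Local cohomology and Castelnuovo-Mumford regularity of ideals *)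

Section Regularity.
Variables (k : fieldType) (n : nat) (I : {mpoly k[n]} -> Prop).
Local Notation K := {fraction {mpoly k[n]}}.

Definition homog_of_deg (d : int) (f : {mpoly k[n]}) : Prop :=
  {in msupp f, forall m, (mdeg m)%:Z = d}.

(* The degree d part of the localization of I at the product x_F of the
   variables indexed by F, as a subset of the fraction field of the
   polynomial ring. *)
Definition loc_deg (F : {set 'I_n}) (d : int) (q : K) : Prop :=
  exists m f, [/\ I f, homog_of_deg (d + (m * #|F|)%:Z) f
                & q * (tofrac (sqfree_mon k F)) ^+ m = tofrac f].

(* The degree d part of the Cech complex of I on x_1, ..., x_n: in cohomological
   degree p it is the sum of the degree d parts of the localizations at the
   x_F with |F| = p. *)
Definition cech_cochain (p d : int) (c : {ffun {set 'I_n} -> K}) : Prop :=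
  forall F : {set 'I_n}, if #|F|%:Z == p then loc_deg F d (c F) else c F = 0.

Definition cech_diff (c : {ffun {set 'I_n} -> K}) : {ffun {set 'I_n} -> K} :=
  [ffun F : {set 'I_n} => \sum_(v in F) (-1) ^+ pos v F * c (F :\ v)].

(* H^p_m(I)_d <> 0, where m = (x_1, ..., x_n). *)
Definition local_cohomology_neq0 (p d : int) : Prop :=
  exists c, [/\ cech_cochain p d c, cech_diff c = 0
              & ~ exists2 b, cech_cochain (p - 1) d b & cech_diff b = c].

Definition is_reg (r : int) : Prop :=
  is_max (fun s => exists p d, local_cohomology_neq0 p d /\ s = p + d) r.

End Regularity.

(** * Critical pairs *)

Definition admissible_pair n (G : hypergraph n) (t : nat)
    (H : hypergraph n) (a : 'X_{1..n}) : Prop :=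
  H = admissible G t a.

Definition critical_pair (k : fieldType) n (G : hypergraph n) (t : nat)
    (H : hypergraph n) (a : 'X_{1..n}) : Prop :=
  admissible_pair G t H a /\ ~ acyclic k (cover_complex k H).

(* Main.v *)
(* J(G)^(t) is a monomial ideal, so its Cech complex splits over Z^n. In the
   degree x^u / (x_1 ... x_n)^M it is the cochain complex of an upset of sets,
   namely of those F such that this Laurent monomial lies in the localization
   at x_F ([in_loc]). If some u_i >= M + t, this upset is a cone. Otherwise let N
   be the set of i with u_i < M, and put a_i = u_i - M off N and a_i = t on N:
   inside the acyclic interval [N, V] the complement of the upset is the
   translate by N of Delta(J(H)) for the admissible H given by a, so for
   N <> V, H^p <> 0 iff H_(p - |N| - 2)(Delta(J(H))) <> 0. The total degree of
   the Laurent monomial is at most |a^{<t}| - |N|, with equality when u_i = M - 1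
   on N, which gives both inequalities for the regularity. For
   N = V the only contribution is p = n in degrees at most -n, hence p + d <= 0. *)
Require Import Defs.
From Stdlib Require Import Classical.
From mathcomp Require Import all_boot all_order all_algebra.
From mathcomp Require Import zify ring.

Set Implicit Arguments.
Unset Strict Implicit.
Unset Printing Implicit Defensive.

Import Order.TTheory GRing.Theory Num.Theory.
Local Open Scope ring_scope.

(** * Linear algebra: solvability of systems with prescribed supports *)

Section Duality.
Variables (k : fieldType) (T : finType).
Implicit Types (A : T -> T -> k) (P Q : pred T) (c z : T -> k).

Definition pairing c z : k := \sum_t c t * z t.

Definition supported P c : Prop := forall t, c t != 0 -> P t.

Lemma supported0 P c t : supported P c -> ~~ P t -> c t = 0.
Proof. by move=> cP; apply: contraNeq => /cP. Qed.

Lemma pairing_eq0 z : (forall c, pairing c z = 0) -> forall t, z t = 0.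
Proof.
move=> z0 t; have := z0 (fun u => (u == t)%:R).
rewrite /pairing (bigD1 t) //= eqxx mul1r big1 ?addr0 // => u /negbTE->.
by rewrite mul0r.
Qed.

(** Either [c] lies in the row space of the block of [A] on [P] times [Q], or a column of the
    cokernel matrix of this block separates it from that space. The alternative is informative, so
    that a solution can later be picked for every exponent at once. *)
Lemma fredholm_alternative A P Q c : supported Q c ->
  {b | supported P b & forall u, Q u -> \sum_t b t * A t u = c u} +
  {z | supported Q z &
       (forall t, P t -> \sum_u A t u * z u = 0) /\ pairing c z != 0}.
Proof.
move=> cQ.
pose B : 'M[k]_#|T| := \matrix_(i, j)
  (if P (enum_val i) && Q (enum_val j) then A (enum_val i) (enum_val j) else 0).
pose v : 'rV[k]_#|T| := \row_j c (enum_val j).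
have [/submxP/sig_eqW[w vE]|nvB] := boolP (v <= B)%MS.
  left; exists (fun t => if P t then w 0 (enum_rank t) else 0) => [t|u uQ].
    by case: ifP; rewrite ?eqxx.
  have /matrixP/(_ 0 (enum_rank u)) := vE; rewrite !mxE enum_rankK => ->.
  rewrite (reindex (@enum_val T predT)) /=; last first.
    exists enum_rank => x _; [exact: enum_valK|exact: enum_rankK].
  apply: eq_bigr => i _; rewrite mxE enum_valK enum_rankK uQ andbT.
  by case: ifP => _; rewrite ?mul0r ?mulr0.
right; move: nvB; rewrite submxE => /rV0Pn/sigW[j vj].
have sumE (F : T -> k) : \sum_u F u = \sum_(i < #|T|) F (enum_val i).
  rewrite (reindex (@enum_val T predT)) //=.
  by exists enum_rank => x _; [exact: enum_valK|exact: enum_rankK].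
exists (fun u => if Q u then cokermx B (enum_rank u) j else 0) => [u|].
  by case: ifP; rewrite ?eqxx.
split=> [t tP|].
  have /matrixP/(_ (enum_rank t) j) := mulmx_coker B.
  rewrite !mxE => BE; rewrite sumE -[RHS]BE; apply: eq_bigr => i _.
  rewrite !mxE enum_valK enum_rankK tP /=.
  by case: ifP => _; rewrite ?mulr0 ?mul0r.
move: vj; rewrite !mxE /pairing sumE; congr (_ != _); apply: eq_bigr => i _.
rewrite mxE enum_valK; case: ifPn => // nQ.
by rewrite (supported0 cQ nQ) !mul0r.
Qed.

End Duality.

(** * Signed incidence, boundary and coboundary on all subsets *)

Section Incidence.
Variable n : nat.
Implicit Types (v w : 'I_n) (F N : {set 'I_n}).

Lemma pos_setD1 v w F : pos v (F :\ w) = (pos v F - ((w \in F) && (w < v)))%N.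
Proof.
rewrite /pos.
have -> : [set j in F :\ w | (j < v)%N] = [set j in F | (j < v)%N] :\ w.
  by apply/setP => j; rewrite !inE andbA.
by rewrite [in RHS](cardsD1 w) inE addKn.
Qed.

Lemma pos_setU1 v w F :
  pos v (w |: F) = (pos v F + ((w \notin F) && (w < v)))%N.
Proof.
have [wF|wF] := boolP (w \in F); first by rewrite (setUidPr _) ?sub1set ?addn0.
have {2}-> : F = (w |: F) :\ w by rewrite setU1K.
rewrite pos_setD1 setU11 /=; case: ltnP => /= wv; rewrite ?subn0 ?addn0 //.
rewrite subnK // /pos card_gt0; apply/set0Pn; exists w.
by rewrite inE setU11.
Qed.

Lemma pos_setU v F N : [disjoint F & N] -> pos v (F :|: N) = (pos v F + pos v N)%N.
Proof.
move=> dFN; rewrite /pos -cardsUI.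
have -> : [set j in F :|: N | (j < v)%N] =
    [set j in F | (j < v)%N] :|: [set j in N | (j < v)%N].
  by apply/setP => j; rewrite !inE andb_orl.
rewrite [X in (_ + X)%N]eq_card0 ?addn0 // => j; rewrite !inE.
by apply/negbTE/negP => /andP[/andP[jF _] /andP[jN _]]; rewrite (disjointFr dFN jF) in jN.
Qed.

(** Removing the smaller vertex lowers the position of the larger one by one, while removing the
    larger changes nothing, so the two orders differ by one sign. *)
Lemma signD1_anticomm (R : pzRingType) v w F : v \in F -> w \in F -> v != w ->
  (-1) ^+ pos v F * (-1) ^+ pos w (F :\ v) =
  - ((-1) ^+ pos w F * (-1) ^+ pos v (F :\ w)) :> R.
Proof.
move=> vF wF nvw; rewrite -!exprD -signr_odd -[X in _ = - X]signr_odd -signrN.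
rewrite !pos_setD1 vF wF /=.
have pos_gt0 (i j : 'I_n) : j \in F -> (j < i)%N -> (0 < pos i F)%N.
  by move=> jF ji; rewrite card_gt0; apply/set0Pn; exists j; rewrite inE jF.
have := pos_gt0 v w wF; have := pos_gt0 w v vF.
have : (v < w)%N || (w < v)%N by rewrite -neq_ltn; exact: nvw.
case: (ltngtP v w) => //= _ _ h1 h2; rewrite ?subn0.
  have [p ->] : exists p, pos w F = p.+1.
    by exists (pos w F).-1; rewrite prednK // h1.
  by rewrite subn1 /= !oddD /=; do 2!case: (odd _).
have [p ->] : exists p, pos v F = p.+1.
  by exists (pos v F).-1; rewrite prednK // h2.
by rewrite subn1 /= !oddD /=; do 2!case: (odd _).
Qed.

Section Operators.
Variable R : comPzRingType.
Implicit Types c z : {set 'I_n} -> R.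

(** Families of faces enter only through supports. The coefficient ring is general because [k], the
    polynomial ring and its fraction field all occur. *)
Definition coboundary c F : R := \sum_(v in F) (-1) ^+ pos v F * c (F :\ v).

Definition bdry z F : R := \sum_(v | v \notin F) (-1) ^+ pos v F * z (v |: F).

(** Matrix entry shared by both operators; the sum has at most one term, as [F] and [F'] determine
    [v]. *)
Definition incidence F F' : R := \sum_(v in F' | F' :\ v == F) (-1) ^+ pos v F'.

Lemma coboundary_incidence c F : coboundary c F = \sum_E c E * incidence E F.
Proof.
under [RHS]eq_bigr do rewrite mulr_sumr big_mkcondr.
rewrite exchange_big; apply: eq_bigr => v vF /=.
rewrite -big_mkcond (big_pred1 (F :\ v)) 1?mulrC //= => E.
Qed.

Lemma bdry_incidence z F : bdry z F = \sum_E incidence F E * z E.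
Proof.
rewrite /bdry.
under [RHS]eq_bigr do rewrite mulr_suml big_mkcond.
rewrite exchange_big /= big_mkcond; apply: eq_bigr => v _.
rewrite -big_mkcond; case: ifPn => vF.
  rewrite (big_pred1 (v |: F)) ?pos_setU1 ?ltnn ?andbF ?addn0 // => E.
  apply/andP/eqP => [[vE /eqP<-]|->]; first by rewrite setD1K.
  by rewrite setU11 setU1K.
rewrite big_pred0 // => E; apply/negP => /andP[vE /eqP EF].
by rewrite -EF setD11 in vF.
Qed.

Lemma eq_coboundary c c' F : c =1 c' -> coboundary c F = coboundary c' F.
Proof. by move=> cE; apply: eq_bigr => v _; rewrite cE. Qed.

Lemma coboundaryK c F : coboundary (coboundary c) F = 0.
Proof.
pose g v w : R := if [&& v \in F, w \in F & v != w] then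
  (-1) ^+ pos v F * (-1) ^+ pos w (F :\ v) * c (F :\ v :\ w) else 0.
have gC v w : g v w = - g w v.
  rewrite /g andbCA eq_sym; case: ifP => [/and3P[wF vF nwv]|]; rewrite ?oppr0 //.
  by rewrite signD1_anticomm // 1?eq_sym // mulNr !setDDl setUC.
have gE : coboundary (coboundary c) F = \sum_v \sum_w g v w.
  rewrite /coboundary big_mkcond; apply: eq_bigr => v _; case: ifPn => vF; last first.
    by rewrite big1 // => w _; rewrite /g (negbTE vF).
  rewrite mulr_sumr big_mkcond; apply: eq_bigr => w _.
  rewrite /g vF !inE eq_sym andbC /=; case: ifP => // _.
  by rewrite mulrA.
(* Antisymmetry by itself only kills twice the sum, so the terms with v < w are cancelled against
   those with w < v; the diagonal is zero by definition of [g]. *)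
have splitg : \sum_v \sum_w g v w =
    \sum_(v < n) \sum_(w < n | (v < w)%N) g v w +
    \sum_(v < n) \sum_(w < n | (w < v)%N) g v w.
  rewrite -big_split; apply: eq_bigr => v _.
  rewrite [LHS](bigID (fun w : 'I_n => (v < w)%N)) /=; congr (_ + _).
  rewrite big_mkcond [RHS]big_mkcond; apply: eq_bigr => w _.
  case: (ltngtP v w) => //= /val_inj->; by rewrite /g eqxx !andbF.
rewrite gE splitg [X in _ + X](exchange_big_dep predT) //= -big_split big1 // => v _.
by rewrite -big_split big1 //= => w _; rewrite gC addNr.
Qed.

Variable v0 : 'I_n.

(** Contracting homotopy of the full simplex seen as a cone with apex [v0]; [cocontraction] is its
    transpose. *)
Definition contraction c F : R :=
  if v0 \in F then 0 else (-1) ^+ pos v0 F * c (v0 |: F).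

Definition cocontraction z F : R :=
  if v0 \in F then (-1) ^+ pos v0 F * z (F :\ v0) else 0.

Lemma coboundary_homotopy c F :
  coboundary (contraction c) F + contraction (coboundary c) F = c F.
Proof.
rewrite /contraction; case: ifPn => v0F.
  rewrite addr0 /coboundary (bigD1 v0) //= setD11 setD1K // pos_setD1 ltnn andbF subn0.
  rewrite mulrA -expr2 sqrr_sign mul1r big1 ?addr0 // => v /andP[vF nv].
  by rewrite !inE v0F eq_sym nv mulr0.
rewrite /coboundary big_setU1 //= setU1K // mulrDr addrCA.
rewrite pos_setU1 ltnn andbF addn0 mulrA -expr2 sqrr_sign mul1r.
rewrite -[RHS]addr0; congr (_ + _).
(* The terms at [v0] have given [c F]. The others cancel in pairs, because only the larger of v and
   [v0] has its position moved by the other. *)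
rewrite mulr_sumr -big_split big1 //= => v vF.
have nvv0 : v != v0 by apply: contraNneq v0F => <-.
rewrite !inE (negbTE v0F) andbF.
have -> : (v0 |: F) :\ v = v0 |: (F :\ v).
  apply/setP => w; rewrite !inE; case: (eqVneq w v0) => //= ->.
  by rewrite eq_sym nvv0.
rewrite pos_setU1 pos_setD1 vF v0F /=.
case: (ltngtP v v0) => [vv0|v0v|/val_inj vE]; last by rewrite vE eqxx in nvv0.
  have [q ->] : exists q, pos v0 F = q.+1.
    exists (pos v0 F).-1; rewrite prednK // card_gt0.
    by apply/set0Pn; exists v; rewrite inE vF.
  by rewrite addn0 subn1 /= exprS; ring.
by rewrite subn0 addn1 exprS; ring.
Qed.

End Operators.
End Incidence.

(** * Dual pairs of a cocycle and a cycle on a family of sets *)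

Section Pairings.
Variables (k : fieldType) (n : nat).
Implicit Types (v : 'I_n) (F N : {set 'I_n}) (c z b : {set 'I_n} -> k).
Implicit Types (P Q : pred {set 'I_n}) (p : int).

Lemma pairing_coboundary c z : pairing (coboundary c) z = pairing c (bdry z).
Proof.
rewrite /pairing.
under eq_bigr do rewrite coboundary_incidence mulr_suml.
rewrite exchange_big; apply: eq_bigr => F _ /=.
by rewrite bdry_incidence mulr_sumr; apply: eq_bigr => E _; rewrite mulrA.
Qed.

(** Transposing twice reduces this to [coboundaryK], the pairing being nondegenerate. *)
Lemma bdryK z F : bdry (bdry z) F = 0.
Proof.
apply: (@pairing_eq0 _ _ (bdry (bdry z))) => c.
rewrite -!pairing_coboundary /pairing big1 // => E _.
by rewrite coboundaryK mul0r.
Qed.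

Lemma pairing_contraction v c z :
  pairing (contraction v c) z = pairing c (cocontraction v z).
Proof.
rewrite /pairing /contraction /cocontraction.
rewrite (bigID (fun F => v \in F)) /= big1 ?add0r => [|F ->]; last by rewrite mul0r.
rewrite [RHS](bigID (fun F => v \notin F)) /= [X in _ = X + _]big1 ?add0r; last first.
  by move=> F /negbTE->; rewrite mulr0.
rewrite [RHS](reindex_onto (fun F => v |: F) (fun F => F :\ v)) /=; last first.
  by move=> F /negPn vF; rewrite setD1K.
apply: eq_big => [F|F vF].
  rewrite setU11 /=; apply/idP/eqP => [vF|<-]; first by rewrite setU1K.
  by rewrite setD11.
rewrite (negbTE vF) setU11 setU1K // pos_setU1 ltnn andbF addn0.
by rewrite mulrA [c _ * _]mulrC.
Qed.

(** Transpose of [coboundary_homotopy]: the defect [x] pairs to zero with every [c]. *)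
Lemma bdry_homotopy v z F :
  bdry (cocontraction v z) F + cocontraction v (bdry z) F = z F.
Proof.
pose x F := bdry (cocontraction v z) F + cocontraction v (bdry z) F - z F.
suff /(_ F)/eqP : forall F, x F = 0 by rewrite subr_eq0 => /eqP.
apply: pairing_eq0 => c.
have -> : pairing c x = pairing c (bdry (cocontraction v z)) +
    pairing c (cocontraction v (bdry z)) - pairing c z.
  by rewrite /pairing -big_split -sumrB; apply: eq_bigr => E _; rewrite mulrBr mulrDr.
rewrite -pairing_contraction -!pairing_coboundary -pairing_contraction.
apply/eqP; rewrite subr_eq0 /pairing -big_split; apply/eqP; apply: eq_bigr => E _.
by rewrite /= -mulrDl [X in X * _]addrC coboundary_homotopy.
Qed.

Definition level P p : pred {set 'I_n} := fun F => P F && (#|F|%:Z == p).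

(* For [P] convex for inclusion, this says that the subquotient of the
   simplicial complex spanned by [P] has nonzero homology, equivalently
   nonzero cohomology, on the sets of cardinality [p]. *)
Definition dual_classes P p : Prop := exists c z : {set 'I_n} -> k,
  [/\ supported (level P p) c, supported (level P p) z,
      forall F, P F -> coboundary c F = 0, forall F, P F -> bdry z F = 0
    & pairing c z != 0].

Definition upset P := forall F F', F \subset F' -> P F -> P F'.
Definition downset P := forall F F', F' \subset F -> P F -> P F'.

Lemma card_setD1 v F : v \in F -> #|F|%:Z = #|F :\ v|%:Z + 1.
Proof. by move=> vF; rewrite (cardsD1 v) vF addnC PoszD. Qed.

Lemma card_setU1 v F : v \notin F -> #|v |: F|%:Z = #|F|%:Z + 1.
Proof. by move=> vF; rewrite cardsU1 vF addnC PoszD. Qed.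

Lemma supported_coboundary P p c :
  supported (level P p) c -> upset P -> supported (level P (p + 1)) (coboundary c).
Proof.
move=> cP upP F; apply: contraNT => nPF; rewrite /coboundary big1 // => v vF.
rewrite (supported0 cP) ?mulr0 //; apply: contra nPF => /andP[PF /eqP<-].
by rewrite /level (upP _ _ (subD1set F v)) //= (card_setD1 vF).
Qed.

Lemma supported_bdry P p z :
  supported (level P p) z -> downset P -> supported (level P (p - 1)) (bdry z).
Proof.
move=> zP downP F; apply: contraNT => nPF; rewrite /bdry big1 // => v vF.
rewrite (supported0 zP) ?mulr0 //; apply: contra nPF => /andP[PF /eqP<-].
by rewrite /level (downP _ _ (subsetUr [set v] F)) //= card_setU1 // addrK.
Qed.

Lemma supported_predT P p c : supported (level P p) c -> supported (level predT p) c.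
Proof. by move=> cP F /cP /andP[]. Qed.

(** Fredholm alternative for the incidence matrix between levels p - 1 and p. The upset condition
    keeps the coboundary of the solution inside [P], so that the equation holds on all sets. *)
Lemma coboundary_or_dual P p c : upset P -> supported (level P p) c ->
  (forall F, coboundary c F = 0) ->
  {b | supported (level P (p - 1)) b & forall F, coboundary b F = c F} +
  {dual_classes P p}.
Proof.
move=> upP cP dc0.
have [[b bP bE]|[z zP [z0 cz]]] :=
  @fredholm_alternative k _ (@incidence n k) (level P (p - 1)) _ _ cP.
  left; exists b => // F; have [/bE<-|nF] := boolP (level P p F).
    exact: coboundary_incidence.
  have := supported_coboundary bP upP; rewrite subrK => /supported0->//.
  by rewrite (supported0 cP).
right; exists c, z; split=> // F PF.
have [FP|nF] := boolP (level P (p - 1) F); first by rewrite bdry_incidence z0.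
apply: (supported0 (supported_bdry (supported_predT zP) _)) => //.
by rewrite /level PF in nF.
Qed.

Lemma bdry_or_dual P p z : downset P -> supported (level P p) z ->
  (forall F, bdry z F = 0) ->
  {b | supported (level P (p + 1)) b & forall F, bdry b F = z F} +
  {dual_classes P p}.
Proof.
move=> downP zP dz0.
have [[b bP bE]|[c cP [c0 cz]]] :=
  @fredholm_alternative k _ (fun E F => @incidence n k F E) (level P (p + 1)) _ _ zP.
  left; exists b => // F; have [/bE<-|nF] := boolP (level P p F).
    by rewrite bdry_incidence; apply: eq_bigr => E _; rewrite mulrC.
  have := supported_bdry bP downP; rewrite addrK => /supported0->//.
  by rewrite (supported0 zP).
right; exists c, z; split=> // [F PF|].
  have [FP|nF] := boolP (level P (p + 1) F).
    by rewrite coboundary_incidence -[RHS](c0 F FP); apply: eq_bigr => E _; rewrite mulrC.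
  apply: (supported0 (supported_coboundary (supported_predT cP) _)) => //.
  by rewrite /level PF in nF.
by move: cz; congr (_ != 0); apply: eq_bigr => E _; rewrite mulrC.
Qed.

(** Stokes formula: the pairing equals that of [b] with [bdry z], which vanishes on the support of
    [b]. *)
Lemma pairing_exact P c z b : supported P b -> (forall F, coboundary b F = c F) ->
  (forall F, P F -> bdry z F = 0) -> pairing c z = 0.
Proof.
move=> bP bE z0; transitivity (pairing (coboundary b) z).
  by apply: eq_bigr => F _; rewrite bE.
rewrite pairing_coboundary /pairing big1 // => F _.
have [/z0->|/(supported0 bP)->] := boolP (P F); [exact: mulr0|exact: mul0r].
Qed.

Lemma pairing_coexact P c z b : supported P b -> (forall F, bdry b F = z F) ->
  (forall F, P F -> coboundary c F = 0) -> pairing c z = 0.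
Proof.
move=> bP bE c0; transitivity (pairing c (bdry b)).
  by apply: eq_bigr => F _; rewrite bE.
rewrite -pairing_coboundary /pairing big1 // => F _.
have [/c0->|/(supported0 bP)->] := boolP (P F); [exact: mul0r|exact: mulr0].
Qed.

Lemma level_supported P p c : supported (level P p) c -> supported P c.
Proof. by move=> cP F /cP/andP[]. Qed.

Lemma upset_coboundary0 P p c : upset P -> supported (level P p) c ->
  (forall F, P F -> coboundary c F = 0) -> forall F, coboundary c F = 0.
Proof.
move=> upP cP c0 F; have [/c0//|nP] := boolP (P F).
by rewrite (supported0 (level_supported (supported_coboundary cP upP))).
Qed.

Lemma downset_bdry0 P p z : downset P -> supported (level P p) z ->
  (forall F, P F -> bdry z F = 0) -> forall F, bdry z F = 0.
Proof.
move=> downP zP z0 F; have [/z0//|nP] := boolP (P F).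
by rewrite (supported0 (level_supported (supported_bdry zP downP))).
Qed.

(** The cone condition keeps the contraction towards [v] supported on [P], and this contraction is a
    primitive of the cocycle. *)
Lemma dual_classes_cone P p v : upset P -> (forall F, P (v |: F) -> P F) ->
  ~ dual_classes P p.
Proof.
move=> upP coneP [c [z [cP zP c0 z0 /eqP]]]; apply.
apply: (@pairing_exact P _ _ (contraction v c)) => // F.
  rewrite /contraction; case: ifP => _; rewrite ?eqxx // mulf_eq0 negb_or.
  by move=> /andP[_ /cP/andP[/coneP]].
rewrite -[RHS](coboundary_homotopy v) [contraction v (coboundary c) F]/contraction.
by rewrite (upset_coboundary0 upP cP) // mulr0 if_same addr0.
Qed.

Definition restrict P c F := if P F then c F else 0.

Lemma supported_restrict P p c :
  (forall F, c F != 0 -> P F -> #|F|%:Z = p) -> supported (level P p) (restrict P c).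
Proof.
move=> cp F; rewrite /restrict /level; case: ifP => PF; rewrite ?eqxx // => cF.
by rewrite (cp F cF PF) eqxx.
Qed.

(* Connecting isomorphism for the split of the acyclic interval [N, setT] into
   [P] and its complement. *)
Lemma dual_classes_interval P N v p : upset P -> v \notin N ->
  (forall F, P F -> N \subset F) ->
  dual_classes P (p + 1) <-> dual_classes (fun F => (N \subset F) && ~~ P F) p.
Proof.
move=> upP vN PN; set Q := fun F : {set 'I_n} => _ && _.
pose I F := N \subset F.
have upI : upset I by move=> F F' sF /subset_trans; apply.
have IE F : I F = P F || Q F.
  by rewrite /Q /I; case: (boolP (P F)) => [/PN|]; rewrite ?andbT.
have PQ F : P F -> ~~ Q F by rewrite /Q => ->; rewrite andbF.
have coboundaryB c d F :
    coboundary (fun F => c F - d F) F = coboundary c F - coboundary d F.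
  by rewrite -sumrB; apply: eq_bigr => w _; rewrite mulrBr.
have bdryB c d F : bdry (fun F => c F - d F) F = bdry c F - bdry d F.
  by rewrite -sumrB; apply: eq_bigr => w _; rewrite mulrBr.
split=> [[c [z [cP zP c0 z0 cz]]]|[b [w [bQ wQ b0 w0 bw]]]].
- have dc0 := upset_coboundary0 upP cP c0.
  (* Since [v] is outside [N], this primitive of [c] stays inside the interval; its part on [Q]
     represents the preimage of the class of [c] under the connecting map. *)
  pose b := contraction v c.
  have db F : coboundary b F = c F.
    rewrite -[RHS](coboundary_homotopy v) [contraction v (coboundary c) F]/contraction.
    by rewrite dc0 mulr0 if_same addr0.
  have bI F : b F != 0 -> I F && (#|F|%:Z == p).
    rewrite /b /contraction; case: ifPn => vF; rewrite ?eqxx // mulf_eq0 negb_or.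
    move=> /andP[_ /cP/andP[/PN NF /eqP]]; rewrite card_setU1 // => /addIr pE.
    have -> : I F.
      apply/subsetP => x xN; have := subsetP NF x xN; rewrite !inE.
      by case: eqVneq => // xv; rewrite -xv xN in vN.
    by rewrite pE eqxx.
  have dz1 : supported (level predT p) (bdry z).
    by have := supported_bdry (supported_predT zP) (fun _ _ _ _ => isT); rewrite addrK.
  (* The connecting map in homology sends [z] to the part of its boundary on [Q]; by adjunction the
     pairing is preserved. *)
  exists (restrict Q b), (restrict Q (bdry z)); split.
  + by apply: supported_restrict => F /bI/andP[_ /eqP].
  + by apply: supported_restrict => F /dz1/andP[_ /eqP].
  + move=> F QF.
    have -> : coboundary (restrict Q b) F =
        coboundary (fun F => b F - restrict P b F) F.
      apply: eq_coboundary => E; rewrite /restrict.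
      have [/PQ/negbTE->|nP] := boolP (P E); first by rewrite subrr.
      rewrite subr0; case: ifPn => // nQ; apply/esym/eqP; apply: contraNT nP.
      by move=> /bI/andP[]; rewrite IE (negbTE nQ) orbF.
    rewrite coboundaryB db.
    have rP : supported (level P p) (restrict P b).
      by apply: supported_restrict => E /bI/andP[_ /eqP].
    have nP : ~~ P F by apply: contraL QF; exact: PQ.
    rewrite (supported0 (level_supported cP)) //.
    by rewrite (supported0 (level_supported (supported_coboundary rP upP))) // subrr.
  + move=> F QF; rewrite -[RHS](bdryK z F) /bdry; apply: eq_bigr => u _.
    congr (_ * _); rewrite /restrict; case: ifPn => // nQ.
    by rewrite -/(bdry z _) z0 //; have := IE (u |: F);
       rewrite (negbTE nQ) orbF => <-; apply: upI (subsetUr _ _) _; rewrite IE QF orbT.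
  + move: cz; congr (_ != 0).
    transitivity (pairing (coboundary b) z).
      by apply: eq_bigr => F _; rewrite db.
    rewrite pairing_coboundary; apply: eq_bigr => F _; rewrite /restrict.
    case: ifPn => // nQ; rewrite mul0r.
    have [PF|nP] := boolP (P F); first by rewrite z0 // mulr0.
    have -> : b F = 0; last by rewrite mul0r.
    by apply/eqP; apply: contraNT nP => /bI/andP[]; rewrite IE (negbTE nQ) orbF.
- have bI : supported (level I p) b.
    by move=> F /bQ/andP[QF]; rewrite /level IE QF orbT.
  have dbI := supported_coboundary bI upI.
  have dbP : supported (level P (p + 1)) (coboundary b).
    move=> F dbF; have := dbI F dbF; rewrite /level IE andb_orl => /orP[//|/andP[QF _]].
    by rewrite b0 ?eqxx in dbF.
  (* Backwards, the cocycle is [coboundary b], which lives on [P] because [b] is a cocycle on [Q].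
     Inside the interval [z] fills [w], and its part on [P] is the required cycle. *)
  pose z := cocontraction v w.
  have zp F : z F != 0 -> #|F|%:Z = p + 1.
    rewrite /z /cocontraction; case: ifPn => vF; rewrite ?eqxx // mulf_eq0 negb_or.
    by move=> /andP[_ /wQ/andP[_ /eqP]]; rewrite (card_setD1 vF) => ->.
  have dwI F : I F -> bdry w F = 0.
    rewrite IE => /orP[PF|/w0//]; rewrite /bdry big1 // => u _.
    rewrite (supported0 wQ) ?mulr0 // /level negb_and PQ //.
    exact: upP (subsetUr _ _) PF.
  have dz F : I F -> bdry z F = w F.
    move=> IF; rewrite -[RHS](bdry_homotopy v) [X in _ = _ + X]/cocontraction.
    case: ifP => vF; rewrite ?addr0 // dwI ?mulr0 ?addr0 //.
    apply/subsetP => x xN; rewrite !inE (subsetP IF) // andbT.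
    by apply: contraNneq vN => <-.
  exists (coboundary b), (restrict P z); split => //.
  + by apply: supported_restrict => F /zp.
  + by move=> F _; rewrite coboundaryK.
  + move=> F PF; transitivity (bdry z F); last first.
      by rewrite dz ?IE ?PF // (supported0 wQ) // /level negb_and PQ.
    by apply: eq_bigr => u _; rewrite /restrict (upP _ _ (subsetUr _ _) PF).
  + move: bw; congr (_ != 0); transitivity (pairing (coboundary b) z); last first.
      apply: eq_bigr => F _; rewrite /restrict; case: ifPn => // nP.
      by rewrite (supported0 (level_supported dbP)) // !mul0r.
    rewrite pairing_coboundary; apply: eq_bigr => F _.
    have [/dz->//|nI] := boolP (I F).
    by rewrite (supported0 (level_supported bI)) // !mul0r.
Qed.

End Pairings.

(** * Translating a family of sets by a disjoint set *)

Section Shift.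
Variables (k : fieldType) (n : nat).
Implicit Types (v : 'I_n) (E F N : {set 'I_n}) (P : pred {set 'I_n}) (p : int).

(** A bijection preserving incidence numbers up to the signs [eps] pulls back cocycles and cycles.
    Both are twisted by [eps], whose square is one, so their pairing is unchanged. *)
Lemma dual_classes_iso P P' p p' (f g : {set 'I_n} -> {set 'I_n})
    (eps : {set 'I_n} -> k) :
  (forall F, P F -> P' (f F)) -> (forall F, P' F -> P (g F)) ->
  (forall F, P F -> g (f F) = F) -> (forall F, P' F -> f (g F) = F) ->
  (forall F, P F -> #|f F|%:Z - p' = #|F|%:Z - p) ->
  (forall F, P F -> eps F * eps F = 1) ->
  (forall E F, P E -> P F ->
     incidence k (f E) (f F) = eps E * eps F * incidence k E F) ->
  dual_classes k P' p' -> dual_classes k P p.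
Proof.
move=> fP gP gK fK cardf eps2 incf [c [z [cP zP c0 z0 cz]]].
pose tr (x : {set 'I_n} -> k) := restrict P (fun F => eps F * x (f F)).
have trP x : supported (level P' p') x -> supported (level P p) (tr x).
  move=> xP F; rewrite /tr /restrict; case: ifP => PF; rewrite ?eqxx // mulf_eq0.
  rewrite negb_or => /andP[_ /xP/andP[_ /eqP E]].
  by have := cardf F PF; rewrite E subrr /level PF => /esym/eqP; rewrite subr_eq0.
have sum_reindex (x : {set 'I_n} -> k) : supported P' x ->
    \sum_E x E = \sum_(E | P E) x (f E).
  move=> xP; rewrite (bigID P') /= [X in _ + X]big1 ?addr0; last first.
    by move=> E nP; rewrite (supported0 xP).
  rewrite (reindex_onto f g) //=; apply: eq_bigl => E.
  apply/andP/idP => [[/gP PE /eqP <-//]|PE].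
  by rewrite fP // gK.
exists (tr c), (tr z); split; [exact: trP|exact: trP| | |].
- move=> F PF; rewrite coboundary_incidence; transitivity (eps F * coboundary c (f F)).
    rewrite coboundary_incidence.
    rewrite (sum_reindex (fun E => c E * incidence k E (f F))); last first.
      by move=> E; rewrite mulf_eq0 negb_or => /andP[cE _]; have /andP[] := cP E cE.
    rewrite mulr_sumr [RHS]big_mkcond; apply: eq_bigr => E _.
    rewrite /tr /restrict; case: ifP => PE; rewrite ?mul0r //.
    by rewrite incf // -[eps E in LHS]mul1r -(eps2 F PF); ring.
  by rewrite c0 ?mulr0 //; exact: fP.
- move=> F PF; rewrite bdry_incidence; transitivity (eps F * bdry z (f F)).
    rewrite bdry_incidence.
    rewrite (sum_reindex (fun E => incidence k (f F) E * z E)); last first.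
      by move=> E; rewrite mulf_eq0 negb_or => /andP[_ /zP/andP[]].
    rewrite mulr_sumr [RHS]big_mkcond; apply: eq_bigr => E _.
    rewrite /tr /restrict; case: ifP => PE; rewrite ?mulr0 //.
    by rewrite incf // -[eps E in LHS]mul1r -(eps2 F PF); ring.
  by rewrite z0 ?mulr0 //; exact: fP.
- move: cz; congr (_ != 0); rewrite /pairing.
  rewrite (sum_reindex (fun E => c E * z E)); last first.
    by move=> E; rewrite mulf_eq0 negb_or => /andP[cE _]; have /andP[] := cP E cE.
  rewrite big_mkcond; apply: eq_bigr => E _; rewrite /tr /restrict.
  case: ifP => PE; rewrite ?mulr0 // -[LHS]mul1r -(eps2 E PE); ring.
Qed.

(** Adding [N] raises the position of v by [pos v N]. Removing v from [F] changes this product by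
    exactly the resulting sign. *)
Definition shift_sign N F : k := \prod_(v in F) (-1) ^+ pos v N.

Lemma shift_sign2 N F : shift_sign N F * shift_sign N F = 1.
Proof.
by rewrite /shift_sign -big_split big1 // => v _; rewrite /= -expr2 sqrr_sign.
Qed.

Lemma setUDK N F : [disjoint F & N] -> (F :|: N) :\: N = F.
Proof. by move=> dFN; rewrite setDUl setDv setU0; apply/setDidPl. Qed.

Lemma incidence_shift N E F : [disjoint E & N] -> [disjoint F & N] ->
  incidence k (E :|: N) (F :|: N) = shift_sign N E * shift_sign N F * incidence k E F.
Proof.
move=> dE dF; rewrite /incidence mulr_sumr; apply: eq_big => v.
  rewrite inE; have [vF|vF] /= := boolP (v \in F).
    have -> : (F :|: N) :\ v = F :\ v :|: N.
      apply/setP => w; rewrite !inE andb_orr; case: eqVneq => //= ->.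
      by rewrite (disjointFr dF vF).
    apply/eqP/eqP => [FE|->//].
    by rewrite -[RHS](setUDK dE) -FE setUDK // (disjointWl (subD1set _ _)).
  apply/negbTE/negP => /andP[vN /eqP/setP/(_ v)].
  by rewrite setD11 inE vN orbT.
rewrite inE => /andP[vFN /eqP FE].
have vN : v \notin N.
  by apply/negP => vN; move/setP/(_ v): FE; rewrite setD11 inE vN orbT.
have vF : v \in F by move: vFN; rewrite (negbTE vN) orbF.
have -> : E = F :\ v.
  rewrite -(setUDK dE) -FE; apply/setP => w; rewrite !inE.
  by case: (boolP (w \in F)) => wF; rewrite ?(disjointFr dF wF) //= ?andbF //;
     case: (w \in N); rewrite ?andbF.
rewrite pos_setU // exprD {2}/shift_sign (big_setD1 v) //= -/(shift_sign N _).
by rewrite mulrCA shift_sign2 mulr1 mulrC.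
Qed.

Lemma dual_classes_shift P N p : (forall F, P F -> [disjoint F & N]) ->
  dual_classes k (fun F => (N \subset F) && P (F :\: N)) (p + #|N|%:Z) <->
  dual_classes k P p.
Proof.
move=> PN; set P' := fun F : {set 'I_n} => _.
pose f F := F :|: N; pose g F := F :\: N.
have fP F : P F -> P' (f F).
  by move=> PF; rewrite /P' /f subsetUr setUDK // PN.
have gP F : P' F -> P (g F) by case/andP.
have gK F : P F -> g (f F) = F by move=> /PN; exact: setUDK.
have fK F : P' F -> f (g F) = F.
  move=> /andP[NF _]; apply/setP => v; rewrite !inE.
  by have := subsetP NF v; case: (v \in N) => [->|]; rewrite ?orbF.
have cardf F : P F -> #|f F|%:Z = #|F|%:Z + #|N|%:Z.
  move=> /PN dF; rewrite -PoszD; congr Posz; apply/eqP.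
  (* Disjointness is the equality case of the bound on the cardinality of a union. *)
  by rewrite -(leq_card_setU F N).2 in dF *.
split.
  apply: (@dual_classes_iso _ _ _ _ f g (shift_sign N)) => //.
  - by move=> F PF; rewrite cardf //; ring.
  - by move=> F _; exact: shift_sign2.
  - by move=> E F /PN dE /PN dF; exact: incidence_shift.
apply: (@dual_classes_iso _ _ _ _ g f (fun F => shift_sign N (g F))) => //.
- by move=> F P'F; rewrite -{2}(fK F P'F) (cardf _ (gP F P'F)); ring.
- by move=> F _; exact: shift_sign2.
move=> E F P'E P'F.
have -> : incidence k E F = incidence k (g E :|: N) (g F :|: N).
  by rewrite -/(f (g E)) -/(f (g F)) !fK.
rewrite incidence_shift ?PN ?gP // mulrA mulrACA !shift_sign2.
by rewrite !mul1r.
Qed.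

End Shift.

(** * Monomials in powers of monomial primes and in symbolic powers *)

Section MonomialIdeals.
Variables (k : fieldType) (n : nat).
Implicit Types (m : 'X_{1..n}) (e F : {set 'I_n}) (f : {mpoly k[n]}).

(** The order of the monomial x^m along the prime generated by the variables of [e]. *)
Definition edge_deg e m : nat := \sum_(i in e) m i.

Lemma edge_degD e m m' : edge_deg e (m + m')%MM = (edge_deg e m + edge_deg e m')%N.
Proof. by rewrite /edge_deg -big_split; apply: eq_bigr => i _; rewrite mnmDE. Qed.

Lemma edge_deg1 e i : edge_deg e U_(i)%MM = (i \in e).
Proof.
rewrite /edge_deg; under eq_bigr do rewrite mnm1E.
have [ie|ie] := boolP (i \in e).
  by rewrite (bigD1 i) //= eqxx big1 // => j /andP[_ /negbTE]; rewrite eq_sym => ->.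
by rewrite big1 // => j je; case: eqP => // ij; rewrite ij je in ie.
Qed.

Lemma var_ideal_msupp e f m : var_ideal k e f -> m \in msupp f -> (0 < edge_deg e m)%N.
Proof.
move=> [g ->] /msupp_sum_le/flattenP[s /mapP[i]].
rewrite mem_filter => /andP[ie _] ->.
rewrite (perm_mem (msuppMX _ _)) => /mapP[m' _ ->].
by rewrite edge_degD edge_deg1 ie.
Qed.

(** For the converse, one variable of [e] is split off each monomial, which lowers its [edge_deg] by
    one, and induction on [t] applies to the cofactors. *)
Lemma ideal_pow_var_msupp e t f :
  ideal_pow (var_ideal k e) t f <->
  forall m, m \in msupp f -> (t <= edge_deg e m)%N.
Proof.
elim: t f => [|t IHt] f; first by split.
split=> [[r [u [v [ue vt ->]]]] m /msupp_sum_le/flattenP[_ /mapP[l _ ->]]|tf].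
  move=> /msuppM_le/allpairsP[[m1 m2] /= [m1u m2v ->]].
  rewrite edge_degD -add1n leq_add //.
    exact: var_ideal_msupp (ue l) m1u.
  by have [/(_ (vt l))/(_ _ m2v)] := IHt (v l).
have pick_var m : m \in msupp f -> exists2 i, i \in e & (0 < m i)%N.
  move=> /tf; case: (boolP [exists i in e, 0 < m i]%N) => [/exists_inP//|].
  rewrite negb_exists_in => /forall_inP m0.
  by rewrite /edge_deg big1 // => i /m0; rewrite lt0n negbK => /eqP.
have /fin_all_exists[w wP] : forall l : 'I_(size (msupp f)),
    exists i, i \in e /\ (0 < (tnth (in_tuple (msupp f)) l) i)%N.
  by move=> l; have [i ie i0] := pick_var _ (mem_tnth l (in_tuple (msupp f))); exists i.
pose mon l := tnth (in_tuple (msupp f)) l.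
(* One product for each monomial of [f]: the chosen variable times the remaining term with its
   coefficient. *)
exists (size (msupp f)), (fun l => 'X_(w l)),
  (fun l => f@_(mon l) *: 'X_[mon l - U_(w l)]).
have monE l : mon l = (mon l - U_(w l) + U_(w l))%MM.
  rewrite submK //; apply/mnm_lepP => j; rewrite mnm1E.
  by case: eqP => [<-|//]; case: (wP l).
split=> [l|l|].
- exists (fun j => if j == w l then 1 else 0); case: (wP l) => wl _.
  rewrite (bigD1 (w l)) //= eqxx mul1r big1 ?addr0 // => j /andP[_ /negbTE->].
  by rewrite mul0r.
- apply/IHt => m /msuppZ_le; rewrite msuppX mem_seq1 => /eqP->.
  have := tf (mon l) (mem_tnth l (in_tuple _)); rewrite {1}monE edge_degD edge_deg1.
  by case: (wP l) => -> _; rewrite addn1.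
rewrite {1}[f]mpolyE big_tnth; apply: eq_bigr => l _.
by rewrite -scalerAr; congr (_ *: _); rewrite -mpolyXD addmC -monE.
Qed.

Lemma sympow_msupp (G : hypergraph n) t f :
  cover_ideal_sympow k G t f <->
  forall m e, m \in msupp f -> e \in eset G -> (t <= edge_deg e m)%N.
Proof.
split=> [ft m e mf eG|ft e eG].
  by have [/(_ (ft e eG))/(_ m mf)] := ideal_pow_var_msupp e t f.
by apply/ideal_pow_var_msupp => m mf; exact: ft.
Qed.

Definition const_mnm F c : 'X_{1..n} := [multinom if i \in F then c else 0%N | i < n].

Lemma sqfree_mon_exp F c : sqfree_mon k F ^+ c = 'X_[const_mnm F c].
Proof.
rewrite mpolyXE_id /sqfree_mon -prodrXl big_mkcond; apply: eq_bigr => i _.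
by rewrite mnmE; case: ifP.
Qed.

Lemma edge_deg_const e F c : edge_deg e (const_mnm F c) = (#|e :&: F| * c)%N.
Proof.
rewrite /edge_deg; under eq_bigr do rewrite mnmE.
by rewrite -big_mkcondr -sum_nat_const; apply: eq_bigl => i; rewrite inE.
Qed.

Lemma mdeg_edge_deg m : mdeg m = edge_deg [set: 'I_n] m.
Proof. by rewrite mdegE; apply: eq_bigl => i; rewrite inE. Qed.

Lemma mdeg_const F c : mdeg (const_mnm F c) = (#|F| * c)%N.
Proof. by rewrite mdeg_edge_deg edge_deg_const setTI. Qed.

Lemma mcoeff_sumX (s : seq 'X_{1..n}) (g : 'X_{1..n} -> k) m : uniq s ->
  (\sum_(j <- s) g j *: 'X_[j])@_m = if m \in s then g m else 0.
Proof.
move=> us; rewrite raddf_sum /=.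
under eq_bigr do rewrite mcoeffZ mcoeffX.
case: ifP => ms.
  rewrite (bigD1_seq m) //= eqxx mulr1 big1 ?addr0 // => j /negbTE->.
  by rewrite mulr0.
rewrite big_seq big1 // => j js; case: eqP => [jm|]; last by rewrite mulr0.
by rewrite jm ms in js.
Qed.

End MonomialIdeals.

Arguments edge_deg {n} e m.
Arguments const_mnm {n} F c.

(** * Multigraded decomposition of the Cech complex *)

Section Localization.
Variables (k : fieldType) (n : nat) (G : hypergraph n) (t : nat).
Implicit Types (m : 'X_{1..n}) (e F : {set 'I_n}) (f : {mpoly k[n]}).
Implicit Types (M : nat) (p d : int).
Local Notation I := (cover_ideal_sympow k G t).
Local Notation K := {fraction {mpoly k[n]}}.
Local Notation xV := (tofrac (sqfree_mon k [set: 'I_n])).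

(* The Laurent monomial x^m / (x_1 ... x_n)^M lies in the localization of
   J(G)^(t) at the product of the variables indexed by [F]. *)
Definition in_loc M m : pred {set 'I_n} := fun F =>
  [forall i, (i \notin F) ==> (M <= m i)%N] &&
  [forall e in eset G, [disjoint e & F] ==> (t + M * #|e| <= edge_deg e m)%N].

Lemma in_locP M m F : reflect
  ((forall i, i \notin F -> (M <= m i)%N) /\
   (forall e, e \in eset G -> [disjoint e & F] -> (t + M * #|e| <= edge_deg e m)%N))
  (in_loc M m F).
Proof.
apply: (iffP andP) => -[h1 h2]; split.
- by move=> i; move/forallP/(_ i)/implyP: h1.
- by move=> e eG; move/forall_inP/(_ e eG)/implyP: h2.
- by apply/forallP => i; apply/implyP/h1.
- by apply/forall_inP => e eG; apply/implyP/h2.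
Qed.

Lemma upset_in_loc M m : upset (in_loc M m).
Proof.
move=> F F' sFF' /in_locP[h1 h2]; apply/in_locP; split=> [i iF'|e eG deF'].
  by apply: h1; apply: contra iF'; exact: (subsetP sFF').
by apply: h2 => //; apply: disjointWr deF'.
Qed.

(** Both sides concern the same Laurent monomial, on the left with a larger denominator. *)
Lemma in_loc_shift M m s F :
  in_loc (M + s) (m + const_mnm [set: 'I_n] s)%MM F = in_loc M m F.
Proof.
apply/in_locP/in_locP => -[h1 h2]; split.
- by move=> i /h1; rewrite mnmDE mnmE inE leq_add2r.
- move=> e eG /(h2 e eG); rewrite edge_degD edge_deg_const setIT.
  by rewrite mulnDl [(s * _)%N]mulnC addnA leq_add2r.
- by move=> i /h1; rewrite mnmDE mnmE inE leq_add2r.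
- move=> e eG /(h2 e eG); rewrite edge_degD edge_deg_const setIT.
  by rewrite mulnDl [(s * _)%N]mulnC addnA leq_add2r.
Qed.

Lemma xV_neq0 M : xV ^+ M != 0.
Proof. by rewrite -tofracXn sqfree_mon_exp tofrac_eq0 -msupp_eq0 msuppX. Qed.

(** A denominator x_F^m0 divides (x_1 ... x_n)^M as soon as m0 <= M. *)
Lemma loc_deg_numerator F d q : loc_deg I F d q -> exists M0, forall M, (M0 <= M)%N ->
  exists f, q * xV ^+ M = tofrac f /\
    forall m, m \in msupp f -> (mdeg m)%:Z = d + (M * n)%:Z /\ in_loc M m F.
Proof.
move=> [m0 [f0 [If0 hom0 qf0]]]; exists m0 => M leM.
(* The complementary factor (x_1 ... x_n)^M / x_F^m0. *)
pose u := (const_mnm F (M - m0) + const_mnm (~: F) M)%MM.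
have uE : const_mnm [set: 'I_n] M = (const_mnm F m0 + u)%MM.
  apply/mnmP => i; rewrite !mnmDE !mnmE !inE.
  by case: (i \in F) => //=; rewrite addn0 subnKC.
exists (f0 * 'X_[u]); split.
  rewrite -tofracXn sqfree_mon_exp uE mpolyXD !tofracM mulrA; congr (_ * _).
  by rewrite -qf0 -tofracXn sqfree_mon_exp.
move=> m; rewrite (perm_mem (msuppMX _ _)) => /mapP[m' m'f ->]; split.
  rewrite addmC mdegD PoszD hom0 // -addrA; congr (_ + _).
  rewrite -PoszD; congr Posz; rewrite [RHS]mulnC.
  have /(congr1 mdeg) := uE; rewrite mdegD !mdeg_const cardsT card_ord => ->.
  by rewrite [(#|F| * _)%N]mulnC.
(* Off [F] the factor [u] supplies the exponent M. On an edge disjoint from [F] it supplies M times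
   the size of the edge, and the monomial of [f0] adds at least t. *)
apply/in_locP; split=> [i iF|e eG deF].
  by rewrite /u !mnmDE !mnmE !inE (negbTE iF) add0n leq_addr.
rewrite addmC !edge_degD !edge_deg_const leq_add //.
  by have [/(_ If0)/(_ m' e m'f eG)] := sympow_msupp G t f0.
have -> : e :&: ~: F = e by apply/setIidPl; rewrite -disjoints_subset.
by rewrite mulnC leq_addl.
Qed.

Lemma numerator_loc_deg F d q M f : q * xV ^+ M = tofrac f ->
  (forall m, m \in msupp f -> (mdeg m)%:Z = d + (M * n)%:Z /\ in_loc M m F) ->
  loc_deg I F d q.
Proof.
(* With x_F^c as denominator, division by (x_1 ... x_n)^M leaves an exponent at least t on each
   variable of [F]; this settles the edges that meet [F]. *)
move=> qf fP; set c := (M + t)%N.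
pose sh m := (m + const_mnm F c - const_mnm [set: 'I_n] M)%MM.
have shK m : m \in msupp f -> (sh m + const_mnm [set: 'I_n] M = m + const_mnm F c)%MM.
  move=> /fP[_ /in_locP[h _]]; rewrite submK //; apply/mnm_lepP => i.
  rewrite mnmDE !mnmE inE; case: ifPn => [_|/h]; last by rewrite addn0.
  by rewrite addnCA leq_addr.
pose f' := \sum_(m <- msupp f) f@_m *: 'X_[sh m].
have f'E : f' * 'X_[const_mnm [set: 'I_n] M] = f * 'X_[const_mnm F c].
  rewrite [in RHS](mpolyE f) !mulr_suml; apply: eq_big_seq => m mf.
  by rewrite -!scalerAl -!mpolyXD shK.
have f'supp m' : m' \in msupp f' -> exists2 m, m \in msupp f & m' = sh m.
  move=> /msupp_sum_le/flattenP[s /mapP[m]].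
  rewrite filter_predT => mf -> /msuppZ_le; rewrite msuppX mem_seq1 => /eqP->.
  by exists m.
exists c, f'; split.
- apply/sympow_msupp => _ e /f'supp[m mf ->] eG.
  have [_ /in_locP[h1 h2]] := fP m mf.
  have [deF|] := boolP [disjoint e & F].
    have := h2 e eG deF; have /(congr1 (edge_deg e)) := shK m mf.
    rewrite !edge_degD !edge_deg_const setIT.
    have /eqP -> : e :&: F == set0 by rewrite setI_eq0.
    by rewrite cards0 mul0n addn0 => <-; rewrite mulnC leq_add2r.
  case/pred0Pn => i /= /andP[ie iF].
  rewrite /edge_deg (bigD1 i) //= (leq_trans _ (leq_addr _ _)) //.
  by rewrite mnmBE mnmDE !mnmE iF inE /c addnCA addKn leq_addl.
- move=> _ /f'supp[m mf ->]; have [dm _] := fP m mf.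
  have /(congr1 mdeg) := shK m mf; rewrite !mdegD !mdeg_const cardsT card_ord.
  by move: dm => dm ds; rewrite [(c * _)%N]mulnC; lia.
apply: (mulIf (xV_neq0 M)); rewrite mulrAC qf -!tofracXn !sqfree_mon_exp.
by rewrite -!tofracM f'E.
Qed.

(** There are finitely many sets [F], so one bound serves all components. Every larger M is allowed,
    so that two cochains can be brought to a common denominator. *)
Lemma cech_cochain_numerator p d (c : {ffun {set 'I_n} -> K}) : cech_cochain I p d c ->
  exists M0, forall M, (M0 <= M)%N -> exists f : {set 'I_n} -> {mpoly k[n]},
    forall F, c F * xV ^+ M = tofrac (f F) /\
      forall m, m \in msupp (f F) ->
        (mdeg m)%:Z = d + (M * n)%:Z /\ level (in_loc M m) p F.
Proof.
move=> cp.
have /fin_all_exists[M0 M0P] : forall F, exists M0, forall M, (M0 <= M)%N ->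
  exists f, c F * xV ^+ M = tofrac f /\ forall m, m \in msupp f ->
        (mdeg m)%:Z = d + (M * n)%:Z /\ level (in_loc M m) p F.
  move=> F; move: (cp F); case: ifP => [Fp /loc_deg_numerator[M0 M0P]|_ ->].
    exists M0 => M /M0P[f [qf fP]]; exists f; split=> // m /fP[? mF].
    by rewrite /level mF Fp.
  by exists 0%N => M _; exists 0; rewrite mul0r tofrac0; split=> // m; rewrite msupp0.
exists (\max_F M0 F) => M leM.
have [f fP] := fin_all_exists (fun F => M0P F M (leq_trans (leq_bigmax F) leM)).
by exists f.
Qed.

Lemma coboundary_raddf (R S : comPzRingType) (phi : {additive R -> S})
    (c : {set 'I_n} -> R) F :
  phi (coboundary c F) = coboundary (fun E => phi (c E)) F.
Proof. by rewrite raddf_sum; apply: eq_bigr => v _; rewrite raddfMsign. Qed.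

Lemma coboundary_mulr (R : comPzRingType) (c : {set 'I_n} -> R) a F :
  coboundary (fun E => c E * a) F = coboundary c F * a.
Proof. by rewrite mulr_suml; apply: eq_bigr => v _; rewrite mulrA. Qed.

Lemma cech_diffE (c : {ffun {set 'I_n} -> K}) F : cech_diff c F = coboundary c F.
Proof. by rewrite ffunE. Qed.

Lemma numerator_coboundary M (c : {ffun {set 'I_n} -> K})
    (f : {set 'I_n} -> {mpoly k[n]}) F :
  (forall E, c E * xV ^+ M = tofrac (f E)) ->
  cech_diff c F * xV ^+ M = tofrac (coboundary f F).
Proof.
move=> cf; rewrite cech_diffE -coboundary_mulr coboundary_raddf.
exact: eq_coboundary.
Qed.

(** If no multidegree of total degree d carried dual classes, every coefficient cochain would have a
    primitive, and these would assemble to a primitive of the Cech cocycle. *)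
Lemma local_cohomology_multidegree p d : local_cohomology_neq0 I p d ->
  exists M m, (mdeg m)%:Z = d + (M * n)%:Z /\ dual_classes k (in_loc M m) p.
Proof.
move=> [c [cp dc0 nb]]; apply: NNPP => noM; apply: nb.
have [M0 /(_ _ (leqnn M0))[f fP]] := cech_cochain_numerator cp.
set M := M0 in fP.
have df0 F : coboundary f F = 0.
  apply/eqP; rewrite -tofrac_eq0 -(@numerator_coboundary M c).
    by rewrite dc0 ffunE mul0r.
  by move=> E; case: (fP E).
pose cm m F : k := (f F)@_m.
have cmP m : supported (level (in_loc M m) p) (cm m).
  by move=> F; rewrite -mcoeff_msupp => /((fP F).2 m)[].
have dcm m F : coboundary (cm m) F = 0.
  by rewrite -(coboundary_raddf (mcoeff m)) df0 raddf0.
(* In multidegrees of the wrong total degree the component vanishes, and zero is its primitive. *)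
have sol m : {b | supported (level (in_loc M m) (p - 1)) b
                & forall F, coboundary b F = cm m F}.
  have [dm|dm] := eqVneq (mdeg m)%:Z (d + (M * n)%:Z); last first.
    exists (fun=> 0) => [F|F]; first by rewrite eqxx.
    rewrite /coboundary big1 => [|v _]; last by rewrite mulr0.
    apply/esym/eqP; apply: contraNT dm; rewrite -mcoeff_msupp.
    by move=> /((fP F).2 m)[-> _].
  have [//|dual] := coboundary_or_dual (@upset_in_loc M m) (cmP m) (dcm m).
  by case: noM; exists M, m.
pose b m := s2val (sol m).
(* Only finitely many monomials occur in the numerators, so the primitives add up to polynomials. *)
pose s := undup (flatten [seq msupp (f F) | F <- enum {set 'I_n}]).
have sP m F : m \notin s -> (f F)@_m = 0.
  rewrite mem_undup => /flattenP nm; apply/eqP; rewrite mcoeff_eq0; apply/negP => mF.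
  by apply: nm; exists (msupp (f F)) => //; apply/mapP; exists F; rewrite ?mem_enum.
have sdeg m : m \in s -> (mdeg m)%:Z = d + (M * n)%:Z.
  by rewrite mem_undup => /flattenP[_ /mapP[F _ ->] /((fP F).2 m)[]].
pose bS F := \sum_(m <- s) b m F *: 'X_[m].
have bSE m F : (bS F)@_m = if m \in s then b m F else 0.
  by rewrite mcoeff_sumX ?undup_uniq.
have bSsupp m F : m \in msupp (bS F) ->
    (mdeg m)%:Z = d + (M * n)%:Z /\ level (in_loc M m) (p - 1) F.
  rewrite mcoeff_msupp bSE; case: ifP => [/sdeg dm|]; rewrite ?eqxx // => bm.
  by split=> //; exact: (s2valP (sol m)) bm.
pose bK := [ffun F => tofrac (bS F) / xV ^+ M].
have bKE F : bK F * xV ^+ M = tofrac (bS F) by rewrite ffunE divfK ?xV_neq0.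
exists bK.
  move=> F; case: ifP => Fp.
    apply: numerator_loc_deg (bKE F) _ => m /bSsupp[? /andP[]]; by split.
  rewrite ffunE; suff -> : bS F = 0 by rewrite tofrac0 mul0r.
  apply/mpolyP => m; rewrite mcoeff0; apply/eqP; rewrite mcoeff_eq0; apply/negP.
  by move=> /bSsupp[_]; rewrite /level Fp andbF.
apply/ffunP => F; apply: (mulIf (xV_neq0 M)).
rewrite (numerator_coboundary F bKE) (fP F).1; congr tofrac.
apply/mpolyP => m; rewrite (coboundary_raddf (mcoeff m)).
have [ms|ms] := boolP (m \in s).
  rewrite -[RHS](s2valP' (sol m)); apply: eq_coboundary => E.
  by rewrite /= bSE ms.
rewrite (sP m F ms) /coboundary big1 // => v _.
by rewrite /= bSE (negbTE ms) mulr0.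
Qed.

(** The cocycle times the Laurent monomial is a Cech cocycle. In a Cech primitive, the coefficients
    of this monomial would form a primitive supported on the upset, which the nonzero pairing
    excludes. *)
Lemma multidegree_local_cohomology p d M m :
  (mdeg m)%:Z = d + (M * n)%:Z -> dual_classes k (in_loc M m) p ->
  local_cohomology_neq0 I p d.
Proof.
move=> dm [c [z [cP zP c0 z0 cz]]].
pose cK := [ffun F => tofrac (c F *: 'X_[m]) / xV ^+ M].
have cKE F : cK F * xV ^+ M = tofrac (c F *: 'X_[m]) by rewrite ffunE divfK ?xV_neq0.
exists cK; split.
- move=> F; case: ifP => Fp.
    apply: numerator_loc_deg (cKE F) _ => j.
    rewrite mcoeff_msupp mcoeffZ mcoeffX mulf_eq0 negb_or => /andP[/cP/andP[mF _]].
    by case: (m =P j) => [<- _|_]; rewrite ?eqxx.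
  rewrite ffunE (supported0 cP) ?scale0r ?tofrac0 ?mul0r //.
  by rewrite /level Fp andbF.
- apply/ffunP => F; apply: (mulIf (xV_neq0 M)).
  rewrite (numerator_coboundary F cKE) ffunE mul0r -[RHS]tofrac0; congr tofrac.
  have -> : coboundary (fun E => c E *: 'X_[m]) F = coboundary c F *: 'X_[m].
    rewrite -mul_mpolyC (coboundary_raddf (@mpolyC n k)) -coboundary_mulr.
    by apply: eq_coboundary => E; rewrite mul_mpolyC.
  by rewrite (upset_coboundary0 (@upset_in_loc M m) cP) // scale0r.
move=> [b bp db]; have [M0 M0P] := cech_cochain_numerator bp.
(* Over the denominator with exponent M + M0, the given Laurent monomial has numerator exponent
   [m1]. *)
have [g gP] := M0P (M + M0)%N (leq_addl _ _).
pose m1 := (m + const_mnm [set: 'I_n] M0)%MM.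
move/eqP: cz; apply.
apply: (@pairing_exact _ _ (in_loc M m) _ _ (fun F => (g F)@_m1)) => //.
  move=> F; rewrite -mcoeff_msupp => /((gP F).2 m1)[_ /andP[]].
  by rewrite in_loc_shift.
move=> F; rewrite -(coboundary_raddf (mcoeff m1)).
suff -> : coboundary g F = c F *: 'X_[m1] by rewrite /= mcoeffZ mcoeffX eqxx mulr1.
apply/eqP; rewrite -tofrac_eq -(@numerator_coboundary (M + M0) b); last first.
  by move=> E; case: (gP E).
rewrite db exprD mulrA cKE -tofracXn sqfree_mon_exp -tofracM.
by rewrite -scalerAl -mpolyXD.
Qed.

End Localization.

(** * Maxima of bounded sets of integers, and reduced homology by duality *)

Lemma exists_is_max (A : int -> Prop) (B : int) :
  (exists s, A s) -> (forall s, A s -> s <= B) -> exists m, is_max A m.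
Proof.
move=> [s As] AB; have [d] : exists d : nat, B - s <= d%:Z.
  by exists `|B - s|%N; lia.
elim: d s As => [|d IHd] s As Bs.
  by exists s; split=> // s' /AB; lia.
have [[s' [As' ss']]|nex] := classic (exists s', A s' /\ s < s').
  by apply: (IHd s') => //; lia.
exists s; split=> // s' As'; rewrite leNgt; apply/negP => ss'.
by apply: nex; exists s'.
Qed.

Section Homology.
Variables (k : fieldType) (n : nat).
Implicit Types (P D : pred {set 'I_n}) (F : {set 'I_n}).

Lemma eq_dual_classes P Q p : P =1 Q -> dual_classes k P p -> dual_classes k Q p.
Proof.
move=> PQ [c [z [cP zP c0 z0 cz]]]; exists c, z.
by split=> // F; [move/cP|move/zP| |]; rewrite /level -PQ //; [exact: c0|exact: z0].
Qed.

Lemma dual_classes_card P p : dual_classes k P p -> exists2 F, P F & p = #|F|%:Z.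
Proof.
move=> [c [z [cP _ _ _ cz]]]; apply: NNPP => nF; move/eqP: cz; apply.
rewrite /pairing big1 // => F _; rewrite (supported0 cP) ?mul0r //.
by apply/negP => /andP[PF /eqP pE]; apply: nF; exists F.
Qed.

(** A cycle that is not a boundary is detected by a cocycle, and a nonzero pairing prevents a cycle
    from bounding. Dimension is cardinality minus one, hence the shift. *)
Lemma red_homology_dual (Delta : {set 'I_n} -> Prop) D i : downset D ->
  (forall F, Delta F <-> D F) ->
  red_homology_neq0 k Delta i <-> dual_classes k D (i + 1).
Proof.
move=> downD DE.
have chainP j (c : {ffun {set 'I_n} -> k}) :
    chain Delta j c <-> supported (level D (j + 1)) c.
  split=> cj F /cj.
    by move=> [/DE DF FE]; rewrite /level DF; apply/eqP; rewrite -FE subrK.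
  by move=> /andP[/DE DF /eqP ->]; rewrite addrK.
split=> [[c [cc dc nb]]|[c [z [cP zP c0 z0 cz]]]].
  have dc0 F : bdry c F = 0 by move/ffunP/(_ F): dc; rewrite !ffunE.
  have [[b bP bE]|//] := bdry_or_dual downD (iffLR (chainP _ _) cc) dc0.
  case: nb; exists [ffun F => b F].
    by apply/chainP => F; rewrite ffunE; exact: bP.
  apply/ffunP => F; rewrite ffunE -bE; apply: eq_bigr => v _.
  by rewrite ffunE.
exists [ffun F => z F]; split.
- by apply/chainP => F; rewrite ffunE; exact: zP.
- apply/ffunP => F; rewrite !ffunE -[RHS](downset_bdry0 downD zP z0 F).
  by apply: eq_bigr => v _; rewrite ffunE.
move=> [b /chainP bP bz]; move/eqP: cz; apply.
apply: (pairing_coexact (level_supported bP)) c0 => F.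
by move/ffunP/(_ F): bz; rewrite !ffunE.
Qed.

End Homology.

(** * Laurent degrees against complexes of admissible subhypergraphs *)

Section CriticalPairs.
Variables (k : fieldType) (n : nat) (G : hypergraph n) (t : nat).
Implicit Types (a m : 'X_{1..n}) (e F : {set 'I_n}) (M : nat) (p d : int).

(** Boolean form of Delta(J(H)), since the duality is set up for decidable families. *)
Definition adm_complex a : pred {set 'I_n} := fun F =>
  (F \subset adm_vset t a) && [exists e in adm_eset G t a, [disjoint F & e]].

Lemma adm_complexP a F :
  cover_complex k (admissible G t a) F <-> adm_complex a F.
Proof.
rewrite SR_coverP /adm_complex; split=> [[-> ex]|/andP[-> ex]].
  by apply/exists_inP.
by split=> //; apply/exists_inP.
Qed.

Lemma downset_adm_complex a : downset (adm_complex a).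
Proof.
move=> F F' sF /andP[FV /exists_inP[e eH dFe]].
rewrite /adm_complex (subset_trans sF FV); apply/exists_inP; exists e => //.
exact: disjointWl dFe.
Qed.

Lemma red_homology_adm a i :
  red_homology_neq0 k (cover_complex k (admissible G t a)) i <->
  dual_classes k (adm_complex a) (i + 1).
Proof. exact: red_homology_dual (@downset_adm_complex a) (adm_complexP a). Qed.

Lemma adm_edge_sub a e : e \in adm_eset G t a -> e \subset adm_vset t a.
Proof. by move=> eH; have /forall_inP/(_ e eH) := adm_eset_sub G t a. Qed.

(** As [F] contains the complement of V(H), only an edge condition can fail. An edge disjoint from
    [F] lies in V(H), and there its condition reads that the sum of a over the edge is at least
    t. *)
Lemma not_in_loc M m a F :
  (forall i, (a i < t)%N = (M <= m i)%N) ->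
  (forall i, (a i < t)%N -> m i = (M + a i)%N) ->
  ~: adm_vset t a \subset F ->
  ~~ in_loc G t M m F = adm_complex a (F :\: ~: adm_vset t a).
Proof.
move=> aM mE NF; set V := adm_vset t a in NF *.
have outF i : i \notin F -> i \in V.
  by move=> iF; apply: contraNT iF => iV; apply: (subsetP NF); rewrite inE.
have degE e : e \subset V ->
    (t + M * #|e| <= edge_deg e m)%N = (t <= \sum_(i in e) a i)%N.
  move=> eV; have -> : edge_deg e m = (\sum_(i in e) a i + M * #|e|)%N.
    rewrite mulnC -sum_nat_const -big_split; apply: eq_bigr => i ie.
    by rewrite [RHS]addnC mE //; have := subsetP eV i ie; rewrite inE.
  by rewrite leq_add2r.
rewrite /adm_complex -/V setDE setCK subsetIr /=.
apply/idP/exists_inP => [nin|[e eH dFe]].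
  have [e eG /andP[deF lte]] : exists2 e, e \in eset G &
      [disjoint e & F] && (edge_deg e m < t + M * #|e|)%N.
    apply/exists_inP; apply: contraNT nin; rewrite negb_exists_in => /forall_inP h.
    apply/in_locP; split=> [i /outF|e eG deF]; first by rewrite inE aM.
    by have := h e eG; rewrite deF /= -leqNgt.
  have eV : e \subset V.
    by apply/subsetP => i ie; apply: outF; rewrite (disjointFr deF ie).
  exists e; first by rewrite inE eG ltnNge -degE // -ltnNge.
  by rewrite disjoint_sym; apply: disjointWr deF; exact: subsetIl.
have eV := adm_edge_sub eH; move: eH; rewrite inE => /andP[eG lte].
apply/negP => /in_locP[_ /(_ e eG)]; rewrite degE // leqNgt lte.
move=> /(_ _)/negP; apply => //.
rewrite disjoint_sym; apply/pred0P => i /=; apply/negP => /andP[iF ie].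
by have := disjointFl dFe ie; rewrite inE iF (subsetP eV).
Qed.

(** Passing to the complement in the interval above [N] accounts for the 1, the translation by [N]
    for its cardinality. A vertex of H serves as the apex outside [N]. *)
Lemma dual_classes_in_loc M m a p :
  (forall i, (a i < t)%N = (M <= m i)%N) ->
  (forall i, (a i < t)%N -> m i = (M + a i)%N) ->
  adm_vset t a != set0 ->
  dual_classes k (in_loc G t M m) (p + #|~: adm_vset t a|%:Z + 1) <->
  dual_classes k (adm_complex a) p.
Proof.
move=> aM mE /set0Pn[v vV]; set N := ~: adm_vset t a.
have inN F : in_loc G t M m F -> N \subset F.
  move=> /in_locP[h _]; apply/subsetP => i; apply: contraLR => /h.
  by rewrite !inE negbK aM.
have vN : v \notin N by rewrite inE negbK.
rewrite (dual_classes_interval k _ (@upset_in_loc _ G t M m) vN inN).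
have dN F : adm_complex a F -> [disjoint F & N].
  by move=> /andP[FV _]; rewrite disjoints_subset setCK.
rewrite -(dual_classes_shift k _ dN).
have PQ F :
    (N \subset F) && ~~ in_loc G t M m F = (N \subset F) && adm_complex a (F :\: N).
  by case: (boolP (N \subset F)) => //= NF; rewrite (not_in_loc aM mE NF).
by split; apply: eq_dual_classes => F; rewrite PQ.
Qed.

(** On an edge through i disjoint from [F], the vertex i alone supplies M + t and each other vertex
    at least M. *)
Lemma in_loc_cone M m i F : (M + t <= m i)%N ->
  in_loc G t M m (i |: F) -> in_loc G t M m F.
Proof.
move=> mi /in_locP[h1 h2].
have h1' j : j \notin F -> (M <= m j)%N.
  have [-> _|ji jF] := eqVneq j i; first exact: leq_trans (leq_addr _ _) mi.
  by apply: h1; rewrite !inE (negbTE ji).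
apply/in_locP; split=> // e eG deF.
have [ie|ie] := boolP (i \in e); last first.
  apply: h2 => //; rewrite disjoint_sym disjoints_subset.
  by apply/subsetP => j; rewrite !inE => /orP[/eqP->//|jF]; rewrite (disjointFl deF jF).
rewrite /edge_deg (bigD1 i) //= (cardsD1 i) ie mulnDr muln1 addnA leq_add //.
  by rewrite addnC.
rewrite mulnC -sum_nat_const (eq_bigl (fun j => (j \in e) && (j != i))); last first.
  by move=> j; rewrite !inE andbC.
by apply: leq_sum => j /andP[je _]; apply: h1'; rewrite (disjointFr deF je).
Qed.

End CriticalPairs.

(** * The regularity formula, from the multigraded computation *)

Theorem lemma2p12 (k : fieldType) (n : nat) (G : hypergraph n) (t : nat)
  (hn : (0 < n)%N)
  (hV : vset G = [set: 'I_n])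
  (hE : eset G != set0)
  (hG : no_isolated_vertex G)
  (ht : (1 <= t)%N) :
  exists m : int,
    is_max (fun s => exists (H : hypergraph n) (a : 'X_{1..n}) (h : int),
              [/\ critical_pair k G t H a,
                  is_hdim k (cover_complex k H) h
                & s = h + (mdeg (trunc_exp t a))%:Z]) m
    /\ is_reg (cover_ideal_sympow k G t) (2 + m).
Proof.
pose A (s : int) := exists (H : hypergraph n) (a : 'X_{1..n}) (h : int),
  [/\ critical_pair k G t H a, is_hdim k (cover_complex k H) h
    & s = h + (mdeg (trunc_exp t a))%:Z].
have homology_bound a i : red_homology_neq0 k (cover_complex k (admissible G t a)) i ->
    -1 <= i < n%:Z.
  move=> /red_homology_adm/dual_classes_card[F _ iE].
  by have := max_card F; rewrite card_ord; lia.
(* The degree i need not be the top one, so only i <= h can be claimed. *)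
have Amem a (i : int) : dual_classes k (adm_complex G t a) (i + 1) ->
    exists2 h : int, i <= h & A (h + (mdeg (trunc_exp t a))%:Z).
  move=> /red_homology_adm hi.
  have [h [hh hmax]] : exists h, is_hdim k (cover_complex k (admissible G t a)) h.
    by apply: (@exists_is_max _ n%:Z) => [|s /homology_bound]; [exists i|lia].
  exists h; first exact: hmax.
  exists (admissible G t a), a, h; split=> //; split=> // acyc.
  exact: acyc hi.
(* An empty edge would be properly contained in an edge through the first vertex. *)
have edge_neq0 e : e \in eset G -> e != set0.
  move=> eG; apply/negP => /eqP e0.
  have [|f fG f0] := hG (Ordinal hn); first by rewrite hV inE.
  have /forall_inP/(_ e eG)/forall_inP/(_ f fG) := eset_antichain G.
  by rewrite e0 properE sub0set subset0; case/negP; apply/set0Pn; exists (Ordinal hn).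
have Aex : exists s, A s.
  have [e eG] := set0Pn _ hE.
  (* For this a, H has vertex set [e] and, by the antichain condition, the single edge [e]. Its
     complex is {∅}, with homology in degree -1. *)
  pose a : 'X_{1..n} := [multinom if i \in e then 0%N else t | i < n].
  have sum_a (f : {set 'I_n}) : (\sum_(i in f) a i < t)%N -> f \subset e.
    move=> lt_t; apply/subsetP => i if_; apply: contraTT lt_t => ie.
    by rewrite -leqNgt (bigD1 i) //= mnmE (negbTE ie) leq_addr.
  have eH : e \in adm_eset G t a.
    by rewrite inE eG big1 // => i ie; rewrite mnmE ie.
  have complexE F : adm_complex G t a F = (F == set0).
    rewrite /adm_complex; apply/andP/eqP => [[/subsetP FV /exists_inP[f]]|->]; last first.
      rewrite sub0set; split=> //; apply/exists_inP; exists e => //.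
      by rewrite disjoints_subset sub0set.
    rewrite inE => /andP[fG /sum_a fe].
    have -> : f = e.
      apply/eqP; rewrite eqEproper fe.
      by have /forall_inP/(_ f fG)/forall_inP/(_ e eG) := eset_antichain G.
    move=> dFe; apply/setP => i; rewrite inE; apply/negbTE/negP => iF.
    by have := FV i iF; rewrite inE mnmE (disjointFr dFe iF) ltnn.
  pose c (F : {set 'I_n}) : k := (F == set0)%:R.
  have cP : supported (level (adm_complex G t a) (-1 + 1)) c.
    move=> F; rewrite /c /level complexE.
    by case: (F =P set0) => [->|_]; rewrite ?cards0 ?eqxx.
  have [|h _ Ah] := Amem a (-1); last by eexists; exact: Ah.
  exists c, c; split=> //.
  - move=> F; rewrite complexE => /eqP->; rewrite /coboundary big_pred0 // => v.
    by rewrite inE.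
  - move=> F _; rewrite /bdry big1 // => v _; rewrite /c.
    have /negbTE-> : v |: F != set0 by apply/set0Pn; exists v; exact: setU11.
    exact: mulr0.
  - rewrite /pairing (bigD1 set0) //= big1 ?addr0 /c ?eqxx ?mulr1 ?oner_neq0 //.
    by move=> F /negbTE->; rewrite mul0r.
(* The upper bound makes the maximum exist; the lower bound settles the case of an empty V(H) at the
   end. *)
have Abound s : A s -> -1 <= s <= (n + n * t)%:Z.
  move=> [H [a [h [[-> _] [/homology_bound hb _] ->]]]].
  suff : (mdeg (trunc_exp t a) <= n * t)%N by lia.
  rewrite mdegE -[X in (_ <= X * _)%N]card_ord -sum_nat_const leq_sum // => i _.
  by rewrite mnmE; case: ifP => // /ltnW.
have [m mmax] : exists m, is_max A m.
  by apply: (@exists_is_max _ (n + n * t)%:Z) => // s /Abound; lia.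
exists m; split=> //; have [Am mub] := mmax; split.
  have [H [a [h [[-> _] [hh _] mE]]]] := Am.
  have dual := iffLR (red_homology_adm k G t a h) hh.
  have V0 : adm_vset t a != set0.
    have [F /andP[_ /exists_inP[e eH _]] _] := dual_classes_card dual.
    have /set0Pn[i ie] : e != set0 by apply: edge_neq0; move: eH; rewrite inE => /andP[].
    by apply/set0Pn; exists i; apply: (subsetP (adm_edge_sub eH)).
  (* Over the denominator x_1 ... x_n, that is M = 1, this is the Laurent monomial with exponents
     a_i on V(H) and -1 elsewhere. *)
  pose m' : 'X_{1..n} := [multinom if (a i < t)%N then (a i).+1 else 0%N | i < n].
  have aM i : (a i < t)%N = (1 <= m' i)%N by rewrite mnmE; case: ifP.
  have m'E i : (a i < t)%N -> m' i = (1 + a i)%N by rewrite mnmE => ->.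
  exists (h + 1 + #|~: adm_vset t a|%:Z + 1), ((mdeg m')%:Z - n%:Z); split.
    apply: (@multidegree_local_cohomology _ _ _ _ _ _ 1 m'); first by rewrite mul1n subrK.
    exact/(dual_classes_in_loc k G (h + 1) aM m'E V0).
  have -> : mdeg m' = (mdeg (trunc_exp t a) + #|adm_vset t a|)%N.
    rewrite !mdegE -sum1_card [X in (_ + X)%N]big_mkcond -big_split.
    apply: eq_bigr => i _.
    by rewrite /= !mnmE inE; case: ifP => _; rewrite ?addn0 ?addn1.
  by have := cardsC (adm_vset t a); rewrite card_ord mE; lia.
move=> _ [p [d [/local_cohomology_multidegree[M [u [du dual]]] ->]]].
have [/existsP[i ui]|] := boolP [exists i, (M + t <= u i)%N].
  case: (@dual_classes_cone k n _ p i (@upset_in_loc _ G t M u) _ dual) => F.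
  exact: in_loc_cone.
rewrite negb_exists => /forallP u_lt.
have {}u_lt i : (u i < M + t)%N by rewrite ltnNge.
(* The value t removes from V(H) exactly the indices with negative Laurent exponent. *)
pose a : 'X_{1..n} := [multinom if (M <= u i)%N then (u i - M)%N else t | i < n].
have aM i : (a i < t)%N = (M <= u i)%N.
  by rewrite mnmE; case: ifP => [Mu|_]; rewrite ?ltnn // ltn_subLR ?u_lt.
have uE i : (a i < t)%N -> u i = (M + a i)%N.
  by rewrite aM mnmE => Mu; rewrite Mu subnKC.
(* Each index outside V(H) has u_i + 1 <= M, so d is at most |a^{<t}| minus the number of these
   indices. *)
have sum_u : (mdeg u + #|~: adm_vset t a| <= M * n + mdeg (trunc_exp t a))%N.
  rewrite !mdegE -[n in (M * n)%N]card_ord mulnC -sum_nat_const -sum1_card.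
  rewrite [X in (_ + X <= _)%N]big_mkcond -!big_split /=; apply: leq_sum => i _.
  have -> : trunc_exp t a i = if (a i < t)%N then a i else 0%N by exact: mnmE.
  rewrite !inE; case: (boolP (a i < t)%N) => [ai|ai] /=; first by rewrite addn0 {1}uE.
  by rewrite addn1 addn0 ltnNge -aM.
(* Here p <= n and d <= -n, so p + d <= 0, whereas 2 + m >= 1. *)
have [V0|V0] := eqVneq (adm_vset t a) set0.
  have [F _ pE] := dual_classes_card dual.
  have /Abound mge := Am.
  have trunc0 : mdeg (trunc_exp t a) = 0%N.
    apply/eqP; rewrite mdeg_eq0; apply/eqP/mnmP => i; rewrite mnm0E mnmE.
    by move/setP/(_ i): V0; rewrite !inE => ->.
  move: sum_u; rewrite V0 setC0 cardsT card_ord trunc0.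
  by have := max_card F; rewrite card_ord; lia.
(* This exposes the homological degree p - |N| - 2, with N the complement of V(H), in the form that
   [Amem] expects. *)
have pE : p = p - #|~: adm_vset t a|%:Z - 2 + 1 + #|~: adm_vset t a|%:Z + 1 by ring.
rewrite {}pE in dual *.
have /Amem[h hge /mub] := iffLR (dual_classes_in_loc k G _ aM uE V0) dual.
lia.
Qed.
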